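(* For every integer $k \ge 3$ there exist rational numbers $c_1(k)$ and $c_2(k)$ such that for every integer $d \ge k$, $$E(d,k) \ge \frac{k}{k+1}\, d - c_1(k) \quad\text{and}\quad E^*(d,k) \ge \frac{k}{k+1}\, d - c_2(k).$$ In particular, for every integer $k\ge 3$ and every real number $\alpha_k < k/(k+1)$, it is not true that for every $d \ge k$ there is a constant $c>0$ (depending on $d$) such that every monic integer polynomial $P(x)$ of degree $d$ with at least $k$ distinct roots $\alpha_1,\dots,\alpha_k$ satisfies $\prod_{1\le i<j\le k}|\alpha_i-\alpha_j| \ge c\, H(P)^{-\alpha_k d}$.
   Context: For a polynomial $P(x)$ with integer coefficients, its (naive) height $H(P)$ is the maximum of the absolute values of its coefficients. Let $k,d$ be integers with $2 \le k \le d$. Define $E(d,k)$ to be the infimum of the real numbers $\delta$ such that $$\prod_{1\le i<j\le k} |\alpha_i - \alpha_j| \ge H(P)^{-\delta}$$ holds for every integer polynomial $P(x)$ of degree $d$ of sufficiently large height having distinct roots $\alpha_1,\dots,\alpha_d$ (for any ordering of these roots, i.e. for any $k$ of its roots). Define $E^*(d,k)$ in the same way, but restricting to monic integer polynomials $P(x)$. *)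

(* Defs.v *)
From mathcomp Require Export all_boot all_order all_algebra.
From mathcomp Require Export all_classical all_reals all_analysis.
From mathcomp Require Export complex.

Set Implicit Arguments.
Unset Strict Implicit.
Unset Printing Implicit Defensive.

Import Order.TTheory GRing.Theory Num.Theory.

Local Open Scope classical_set_scope.
Local Open Scope ring_scope.

Definition height (P : {poly int}) : nat :=
  (\max_(i < size P) absz (P`_i)%R)%N.

Definition distinct_roots (R : realType) (P : {poly int}) (s : seq R[i]) : Prop :=
  uniq s /\ all (root (map_poly intr P)) s.

(* Only the first [k] entries of [s] are used. *)
Definition root_dist_prod (R : realType) (k : nat) (s : seq R[i]) : R :=
  \prod_(j < k) \prod_(i < j) ComplexField.Normc.normc (s`_i - s`_j).

(* The exponents [delta] admissible for the polynomials of degree [d] in the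
   class [A].  The enumeration [s] of the [d] roots is arbitrary, so its first
   [k] entries are any [k] of the roots, in any order. *)
Definition separation_exponents (R : realType) (A : set {poly int})
    (d k : nat) : set R :=
  [set delta | exists H0 : nat, forall (P : {poly int}) (s : seq R[i]),
     A P -> size P = d.+1 -> (H0 <= height P)%N ->
     size s = d -> distinct_roots P s ->
     (height P)%:R `^ (- delta) <= root_dist_prod k s].

(* The infimum is taken in the extended reals because [inf] on [R] has the
   default value 0 on sets that are empty or not bounded below. *)
Definition E (R : realType) (d k : nat) : \bar R :=
  ereal_inf (EFin @` @separation_exponents R setT d k).

Definition Estar (R : realType) (d k : nat) : \bar R :=
  ereal_inf (EFin @` @separation_exponents R [set P | P \is monic] d k).

(* Main.v *)
(** Let [a] be a large integer.  The monic cubic [M = X (X - a)^2 - a] has a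
    real root [x] close to [1/a], and [z = x^2 - a x + 1] satisfies
    [z^2 = z + x^2], so that [z] is of order [a^-2].  The recurrence
    [Q_0 = 1], [Q_1 = X^2 - a X + 1], [Q_(n+2) = Q_(n+1) + X^2 Q_n] produces
    polynomials of height [O(a)] with [Q_n(x) = z^n] and [Q_n'(x)] of order
    [-a]; hence [Q_n] has a root at distance [O(a^(-2n))] from [x].  For odd
    [n], [Q_n] is monic of degree [n + 1].

    Multiply [M] by [k - 1] different polynomials [Q_n] with odd [n] close to
    [d / (k - 1)], and by [X] if the parity of [d] requires it.  The product is
    monic of degree [d] and of height [O(a^(k+1))], and it has [k] roots
    within [O(a^(-2d/(k-1) + O(1)))] of each other; the product of their
    [k (k - 1) / 2] distances is [O(a^(-kd + O(1)))].

    Its roots are distinct for all but finitely many [a]: [Q_n] is affine in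
    [a], so that a double root, or a common root of two factors, lies in a
    finite set independent of [a], and each point is a root of [Q_n] for at
    most one [a].  The bounded degrees are covered by [X^d - N], and [E]
    dominates [Estar]. *)

Require Import Defs.
From mathcomp Require Import separable ring lra zify.

Set Implicit Arguments.
Unset Strict Implicit.
Unset Printing Implicit Defensive.

Import Order.TTheory GRing.Theory Num.Theory.

Local Open Scope classical_set_scope.
Local Open Scope ring_scope.

(** * Second-order recurrences *)

(** The recursion advances the pair of initial values, so inductions on [n] generalize over [u] and
    [v]; [lucasSS] recovers the usual recurrence. *)
Fixpoint lucas (A : comNzRingType) (x u v : A) (n : nat) : A :=
  if n is n'.+1 then lucas x v (v + x ^+ 2 * u) n' else u.

Lemma lucasSS (A : comNzRingType) (x u v : A) (n : nat) :
  lucas x u v n.+2 = lucas x u v n.+1 + x ^+ 2 * lucas x u v n.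
Proof. by elim: n u v => [|n IH] u v //; apply: IH. Qed.

Lemma rmorph_lucas (A B : comNzRingType) (f : {rmorphism A -> B})
    (x u v : A) (n : nat) :
  f (lucas x u v n) = lucas (f x) (f u) (f v) n.
Proof.
by elim: n u v => [|n IH] u v //=; rewrite IH rmorphD rmorphM rmorphXn.
Qed.

Lemma lucasB (A : comNzRingType) (x c u v c' u' v' : A) (n : nat) :
  lucas x (c * u - c' * u') (c * v - c' * v') n =
  c * lucas x u v n - c' * lucas x u' v' n.
Proof.
elim: n u v u' v' => [|n IH] u v u' v' //=; rewrite -IH.
by congr lucas; ring.
Qed.

Lemma lucasZ (A : comNzRingType) (x c u v : A) (n : nat) :
  lucas x (c * u) (c * v) n = c * lucas x u v n.
Proof.
by have := lucasB x c u v 0 0 0 n; rewrite !mul0r !subr0.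
Qed.

(** A geometric sequence solves the recurrence when its ratio satisfies the characteristic
    equation. *)
Lemma lucas_exp (A : comNzRingType) (x z : A) (n : nat) :
  z ^+ 2 = z + x ^+ 2 -> lucas x 1 z n = z ^+ n.
Proof.
(* One step turns the initial pair [(c, c z)] into [(c z, c z ^ 2)], hence the scalar [c] in the
   induction. *)
move=> hz; suff H c : lucas x c (c * z) n = c * z ^+ n.
  by have := H 1; rewrite !mul1r.
elim: n c => [|n IH] c /=; first by rewrite expr0 mulr1.
have -> : c * z + x ^+ 2 * c = c * z * z by rewrite -mulrA -expr2 hz; ring.
by rewrite IH exprS mulrA.
Qed.

Lemma lucas0 (A : comNzRingType) (u v : A) (n : nat) : lucas 0 u v n.+1 = v.
Proof.
by elim: n u v => [|n IH] u v //; rewrite -[RHS](IH u v) /= !expr0n !mul0r !addr0.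
Qed.

(** The left side is a Casoratian, the discrete analogue of a Wronskian: raising [n] by one
    multiplies it by [- x ^ 2]. It serves to control common zeros. *)
Lemma lucas_casorati (A : comNzRingType) (x u v u' v' : A) (n s : nat) :
  lucas x u v (n + s) * lucas x u' v' n -
    lucas x u v n * lucas x u' v' (n + s) =
  (- x ^+ 2) ^+ n * lucas x 0 (v * u' - u * v') s.
Proof.
elim: n u v u' v' => [|n IH] u v u' v' /=.
  have -> : lucas x 0 (v * u' - u * v') s =
      lucas x (u' * u - u * u') (u' * v - u * v') s by congr lucas; ring.
  by rewrite lucasB expr0 !add0n; ring.
have e : lucas x 0 ((v + x ^+ 2 * u) * v' - v * (v' + x ^+ 2 * u')) s =
    - x ^+ 2 * lucas x 0 (v * u' - u * v') s.
  by rewrite -lucasZ; congr lucas; ring.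
by rewrite IH e [in RHS]exprSr mulrA.
Qed.

(** At [x = 1] one step replaces [u + v] by [u + 2 v], which is at most twice as large. *)
Lemma lucas1_le (u v : int) (n : nat) :
  0 <= u -> 0 <= v -> lucas 1 u v n <= 2 ^+ n * (u + v).
Proof.
elim: n u v => [|n IH] u v u0 v0 /=; first by rewrite expr0 mul1r lerDl.
rewrite expr1n mul1r; apply: (le_trans (IH _ _ _ _)); rewrite ?addr_ge0 //.
by rewrite exprSr -mulrA ler_pM2l ?exprn_gt0 //; lia.
Qed.

(** * The approximating polynomials *)

(* Modulo [cubic a], the element [z = 'X^2 - a 'X + 1] satisfies
   [z^2 = z + 'X^2], hence [qpoly a n] represents [z^n] although its
   coefficients are only of order [a]. *)
Definition qpoly (A : comNzRingType) (a n : nat) : {poly A} :=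
  lucas 'X 1 ('X^2 - a%:R * 'X + 1) n.

Definition cubic (A : comNzRingType) (a : nat) : {poly A} :=
  'X * ('X - a%:R) ^+ 2 - a%:R.

Lemma map_qpoly (A B : comNzRingType) (f : {rmorphism A -> B}) (a n : nat) :
  map_poly f (qpoly A a n) = qpoly B a n.
Proof.
rewrite rmorph_lucas rmorph1 rmorphD rmorphB rmorphXn rmorphM /= map_polyX.
by rewrite rmorph_nat rmorph1.
Qed.

Lemma map_cubic (A B : comNzRingType) (f : {rmorphism A -> B}) (a : nat) :
  map_poly f (cubic A a) = cubic B a.
Proof.
by rewrite rmorphB rmorphM rmorphXn rmorphB /= map_polyX rmorph_nat.
Qed.

Lemma horner_nat (A : comNzRingType) (a : nat) (x : A) :
  (a%:R : {poly A}).[x] = a%:R.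
Proof. by rewrite -polyC_natr hornerC. Qed.

Lemma horner_lucas (A : comNzRingType) (u v : {poly A}) (x : A) (n : nat) :
  (lucas 'X u v n).[x] = lucas x u.[x] v.[x] n.
Proof.
by rewrite -[LHS]/(horner_eval x _) rmorph_lucas /= /horner_eval hornerX.
Qed.

Lemma horner_qpoly (A : comNzRingType) (a n : nat) (x : A) :
  (qpoly A a n).[x] = lucas x 1 (x ^+ 2 - a%:R * x + 1) n.
Proof. by rewrite horner_lucas !hornerE horner_nat. Qed.

Lemma horner_cubic (A : comNzRingType) (a : nat) (x : A) :
  (cubic A a).[x] = x * (x - a%:R) ^+ 2 - a%:R.
Proof. by rewrite !hornerE horner_nat. Qed.

(** With [z = x ^ 2 - a x + 1], the difference [z ^ 2 - z - x ^ 2] is [x] times the value of the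
    cubic at [x]. *)
Lemma qpoly_root_cubic (A : idomainType) (a n : nat) (x : A) :
  root (cubic A a) x -> (qpoly A a n).[x] = (x ^+ 2 - a%:R * x + 1) ^+ n.
Proof.
move/rootP; rewrite horner_cubic horner_qpoly => h; apply: lucas_exp.
apply/eqP; rewrite -subr_eq0; apply/eqP.
by rewrite -[RHS](mulr0 x) -h; ring.
Qed.

Lemma qpoly_linear (A : comNzRingType) (a n : nat) (x : A) :
  (qpoly A a n).[x] = lucas x 1 (x ^+ 2 + 1) n - a%:R * lucas x 0 x n.
Proof.
rewrite horner_qpoly -[lucas x 1 (x ^+ 2 + 1) n]mul1r -lucasB.
by congr lucas; ring.
Qed.

Lemma qpoly_at0 (A : comNzRingType) (a n : nat) : (qpoly A a n).[0] = 1.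
Proof.
by case: n => [|n]; rewrite horner_qpoly // lucas0 expr0n mulr0 subr0 add0r.
Qed.

Lemma cubic_monic_size (A : idomainType) (a : nat) :
  cubic A a \is monic /\ size (cubic A a) = 4.
Proof.
have sa : size ('X * ('X - a%:R%:P) ^+ 2 : {poly A}) = 4.
  by rewrite mulrC size_mulX ?expf_neq0 ?polyXsubC_eq0 // size_exp_XsubC.
have sl : (size (- a%:R : {poly A})%R < size ('X * ('X - a%:R%:P) ^+ 2 : {poly A})%R)%N.
  by rewrite sa size_polyN -polyC_natr (leq_ltn_trans (size_polyC_leq1 _)).
rewrite polyC_natr in sl sa; split.
  rewrite monicE lead_coefDl // -polyC_natr -monicE.
  by rewrite monicMl ?monicX // monic_exp // monicXsubC.
by rewrite size_polyDl.
Qed.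

Lemma qpoly_monic_size (A : idomainType) (a j : nat) :
  qpoly A a j.*2.+1 \is monic /\ size (qpoly A a j.*2.+1) = (j.*2 + 3)%N.
Proof.
(* At odd indices the leading term comes from ['X^2] times the polynomial two steps back; the bound
   at even indices keeps the other summand of lower degree. *)
suff: (size (qpoly A a j.*2) <= j.*2.+1)%N /\
  qpoly A a j.*2.+1 \is monic /\ size (qpoly A a j.*2.+1) = (j.*2 + 3)%N by case.
elim: j => [|j [IH0 [IH1 IH2]]].
  rewrite /qpoly /= size_poly1; split=> //.
  have sl : (size (- (a%:R * 'X) + 1 : {poly A})%R < size ('X^2 : {poly A})%R)%N.
    rewrite size_polyXn ltnS (leq_trans (size_polyD _ _)) // geq_max size_poly1.
    rewrite size_polyN andbT -polyC_natr mul_polyC.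
    by rewrite (leq_trans (size_scale_leq _ _)) // size_polyX.
  split; rewrite -addrA; last by rewrite size_polyDl // size_polyXn.
  by rewrite monicE lead_coefDl // lead_coefXn.
have s2 (p : {poly A}) : p != 0 -> size ('X^2 * p) = (size p).+2.
  by move=> p0; rewrite mulrC size_mulXn.
have s2' (p : {poly A}) : (size ('X^2 * p : {poly A})%R <= (size p).+2)%N.
  by have [->|p0] := eqVneq p 0; rewrite ?mulr0 ?size_poly0 // s2.
have e2 : (size (qpoly A a j.+1.*2) <= j.+1.*2.+1)%N.
  rewrite /qpoly doubleS lucasSS -!/(qpoly _ _ _).
  rewrite (leq_trans (size_polyD _ _)) // geq_max IH2.
  rewrite (leq_trans (s2' _)) ?andbT; first by rewrite addn3.
  by rewrite !ltnS.
have n1 := monic_neq0 IH1.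
have sl : (size (qpoly A a j.*2.+2) < size ('X^2 * qpoly A a j.*2.+1)%R)%N.
  by rewrite s2 // IH2 (leq_ltn_trans e2) // doubleS; lia.
split=> //; rewrite /qpoly doubleS lucasSS -!/(qpoly _ _ _) addrC; split.
  by rewrite monicE lead_coefDl // -monicE monicMl // monicXn.
by rewrite size_polyDl // s2 // IH2; lia.
Qed.

(** * Separability for large parameters *)

Definition eventuallyN (Q : nat -> Prop) := exists N, forall a, (N <= a)%N -> Q a.

Lemma eventuallyNI (Q Q' : nat -> Prop) :
  eventuallyN Q -> eventuallyN Q' ->
  eventuallyN (fun a => Q a /\ Q' a).
Proof.
move=> [N hN] [N' hN']; exists (maxn N N') => a.
by rewrite geq_max => /andP[/hN ? /hN'].
Qed.

Lemma eventuallyN_all (T : eqType) (Q : T -> nat -> Prop) (s : seq T) :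
  (forall t, t \in s -> eventuallyN (Q t)) ->
  eventuallyN (fun a => forall t, t \in s -> Q t a).
Proof.
elim: s => [|t s IH] h; first by exists 0%N => a _ t; rewrite in_nil.
have [|N hN] := eventuallyNI (h t (mem_head _ _)) (IH _).
  by move=> u us; apply: h; rewrite inE us orbT.
by exists N => a /hN [h1 h2] u; rewrite inE => /orP[/eqP->|/h2].
Qed.

(* [qpoly] is affine in [a], with coefficients that have no common zero, so a
   given [y] is a root for at most one value of [a]. *)
Lemma qpoly_not_root (C : numClosedFieldType) (y : C) (n : nat) :
  eventuallyN (fun a => (qpoly C a n).[y] != 0).
Proof.
have [->|y0] := eqVneq y 0; first by exists 0%N => a _; rewrite qpoly_at0 oner_eq0.
have [[a0 /eqP h0]|no] := pselect (exists a0, (qpoly C a0 n).[y] == 0); last first.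
  by exists 0%N => a _; apply/negP => h; apply: no; exists a.
exists a0.+1 => a lta; apply/eqP; move: h0; rewrite !qpoly_linear => h0 h1.
have v0 : lucas y 0 y n = 0.
  have : (a%:R - a0%:R) * lucas y 0 y n =
      (lucas y 1 (y ^+ 2 + 1) n - a0%:R * lucas y 0 y n) -
      (lucas y 1 (y ^+ 2 + 1) n - a%:R * lucas y 0 y n) by ring.
  rewrite h0 h1 subrr => /eqP.
  by rewrite mulf_eq0 subr_eq0 eqr_nat gtn_eqF // => /eqP.
(* Both coefficients of the affine function of [a] vanish at [y], so the Casoratian with shift 1 is
   zero, although up to sign it is a power of [y]. *)
have := lucas_casorati y 1 (y ^+ 2 + 1) 0 y n 1.
move: h0; rewrite v0 mulr0 subr0 => ->; rewrite mul0r mulr0 subrr /=.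
move/esym/eqP; rewrite mulf_eq0 expf_eq0 oppr_eq0 expf_eq0 (negbTE y0) /= andbF /=.
by rewrite mulr0 mul1r sub0r oppr_eq0 (negbTE y0).
Qed.

Lemma poly_zeros_seq (C : numClosedFieldType) (p : {poly C}) :
  p != 0 -> {s : seq C | forall y, root p y -> y \in s}.
Proof.
move=> p0; have [s hs] := closed_field_poly_normal p; exists s => y.
by rewrite hs rootZ ?lead_coef_eq0 // root_prod_XsubC.
Qed.

(** At a common root the Casoratian vanishes, which makes the root a zero of [lucas 'X 0 1 s.+1].
    This polynomial does not involve [a], so finitely many points remain, and [qpoly_not_root]
    excludes each of them for large [a]. *)
Lemma qpoly_coprime_add (C : numClosedFieldType) (n s : nat) :
  eventuallyN (fun a => coprimep (qpoly C a n) (qpoly C a (n + s.+1))).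
Proof.
have V0 : lucas 'X 0 1 s.+1 != 0 :> {poly C}.
  apply/eqP => /(congr1 (horner^~ 0)); rewrite horner_lucas !hornerE lucas0.
  by apply/eqP; rewrite oner_eq0.
have [ys hys] := poly_zeros_seq V0.
have [N hN] := eventuallyN_all (fun y (_ : y \in ys) => qpoly_not_root y n).
exists N => a aN; apply/Pdiv.ClosedField.coprimepP => y ry.
apply/eqP => h'; have /rootP h := ry.
have y0 : y != 0.
  by apply/eqP => y0; move: h; rewrite y0 qpoly_at0 => /eqP; rewrite oner_eq0.
suff /hys/(hN a aN) : root (lucas 'X 0 1 s.+1) y by rewrite h eqxx.
rewrite !qpoly_linear in h h'; rewrite /root horner_lucas !hornerE.
have := lucas_casorati y 1 (y ^+ 2 + 1) 0 y n s.+1.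
rewrite (subr0_eq h) (subr0_eq h').
have -> : lucas y 0 ((y ^+ 2 + 1) * 0 - 1 * y) s.+1 = - y * lucas y 0 1 s.+1.
  by rewrite -lucasZ; congr lucas; ring.
move=> e.
have /eqP : (- y ^+ 2) ^+ n * (- y * lucas y 0 1 s.+1) = 0 by rewrite -e; ring.
by rewrite !mulf_eq0 expf_eq0 !oppr_eq0 expf_eq0 (negbTE y0) !andbF.
Qed.

Lemma qpoly_coprime (C : numClosedFieldType) (n m : nat) : n != m ->
  eventuallyN (fun a => coprimep (qpoly C a n) (qpoly C a m)).
Proof.
rewrite neq_ltn => /orP[] lt.
  by have := qpoly_coprime_add C n (m - n.+1); rewrite -addSnnS subnKC.
have := qpoly_coprime_add C m (n - m.+1); rewrite -addSnnS subnKC // => -[N hN].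
by exists N => a /hN; rewrite coprimep_sym.
Qed.

(* A double root of [U - a V] is a zero of the Wronskian [U V' - U' V]. *)
Lemma qpoly_separable (C : numClosedFieldType) (n : nat) :
  eventuallyN (fun a => separable_poly (qpoly C a n)).
Proof.
case: n => [|n].
  by exists 0%N => a _; rewrite unlock /qpoly /= coprime1p.
pose U : {poly C} := lucas 'X 1 ('X^2 + 1) n.+1.
pose B : {poly C} := lucas 'X 0 1 n.+1.
have eV (A : comNzRingType) (x : A) m : lucas x 0 x m = x * lucas x 0 1 m.
  by rewrite -lucasZ mulr0 mulr1.
pose W := U * ('X * B)^`() - U^`() * ('X * B).
(* The value of [W] at 0 is [U(0) B(0) = 1]. *)
have W0 : W != 0.
  apply/eqP => /(congr1 (horner^~ 0)); rewrite /W derivM derivX mul1r.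
  rewrite !hornerE [U.[0]]horner_lucas [B.[0]]horner_lucas !lucas0 !hornerE.
  by rewrite expr0n /= add0r mulr1 mulr0 subr0 => /eqP; rewrite oner_eq0.
have [ys hys] := poly_zeros_seq W0.
have [N hN] := eventuallyN_all (fun y (_ : y \in ys) => qpoly_not_root y n.+1).
exists N => a aN; rewrite unlock; apply/Pdiv.ClosedField.coprimepP => y ry.
have /rootP h := ry.
apply/eqP => h'; suff /hys/(hN a aN) : root W y by rewrite h eqxx.
have eq : qpoly C a n.+1 = U - a%:R%:P * ('X * B).
  rewrite -eV /U -[X in X - _]mul1r -lucasB /qpoly polyC_natr.
  by congr lucas; ring.
move: h h'; rewrite {}eq derivB derivM derivC mul0r add0r.
rewrite !(hornerD, hornerN, hornerM, hornerC, hornerX) 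
  => /subr0_eq h /subr0_eq h'.
rewrite /root /W !(hornerD, hornerN, hornerM, hornerX) h h'.
by apply/eqP; ring.
Qed.

Lemma cubic_at0 (C : numClosedFieldType) (a : nat) : (cubic C a).[0] = - a%:R.
Proof. by rewrite horner_cubic mul0r sub0r. Qed.

Lemma cubic_separable (C : numClosedFieldType) (a : nat) :
  (2 < a)%N -> separable_poly (cubic C a).
Proof.
move=> a2; rewrite unlock; apply/Pdiv.ClosedField.coprimepP => y /rootP.
rewrite horner_cubic => h; apply/eqP.
(* A double root would be [a] or [a / 3]; the cubic is [- a] at the former, and at the latter it
   vanishes only if [4 a ^ 2 = 27]. *)
have -> : (cubic C a)^`() = ('X - a%:R%:P) * (3%:R%:P * 'X - a%:R%:P).
  rewrite /cubic -!polyC_natr expr2 !(derivB, derivM, derivX, derivC).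
  by rewrite !polyC_natr; ring.
rewrite !hornerE => /eqP; rewrite mulf_eq0 => /orP[] /eqP h'.
  move: h; rewrite h' expr0n mulr0 sub0r => /eqP.
  by rewrite oppr_eq0 pnatr_eq0; case: (a) a2.
have : a%:R * (4 * a%:R ^+ 2 - 27) = 0 :> C.
  by rewrite -[RHS](mulr0 27) -h (_ : a%:R = 3 * y); [ring|rewrite (subr0_eq h')].
move/eqP; rewrite mulf_eq0 pnatr_eq0 subr_eq0 => /orP[/eqP a0|]; first by rewrite a0 in a2.
rewrite -natrX -natrM eqr_nat => /eqP; nia.
Qed.

(** A common root [y] has [z = 0], and [z (y - a)] minus the cubic is [y]; so [y = 0], where the
    cubic is [- a]. *)
Lemma cubic_qpoly_coprime (C : numClosedFieldType) (a n : nat) : (0 < a)%N ->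
  coprimep (cubic C a) (qpoly C a n).
Proof.
move=> a0; apply/Pdiv.ClosedField.coprimepP => y ry.
rewrite (qpoly_root_cubic _ ry) expf_eq0 negb_and; apply/orP; right.
apply/eqP => z0; move/rootP: ry; rewrite horner_cubic => h.
have y0 : y = 0.
  have -> : y = (y ^+ 2 - a%:R * y + 1) * (y - a%:R) -
      (y * (y - a%:R) ^+ 2 - a%:R) by ring.
  by rewrite h z0 mul0r subrr.
move: h; rewrite y0 mul0r sub0r => /eqP; rewrite oppr_eq0 pnatr_eq0.
by case: (a) a0.
Qed.

(** * Heights *)

(** Majorants are stable under ring operations, and the height is at most the value of a majorant at
    1. *)
Definition dominated (P S : {poly int}) := forall i, `|P`_i| <= S`_i.

Lemma dominatedD P S P' S' :
  dominated P S -> dominated P' S' -> dominated (P + P') (S + S').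
Proof.
by move=> h h' i; rewrite !coefD (le_trans (ler_normD _ _)) // lerD.
Qed.

Lemma dominatedN P S : dominated P S -> dominated (- P) S.
Proof. by move=> h i; rewrite coefN normrN. Qed.

Lemma dominatedM P S P' S' :
  dominated P S -> dominated P' S' -> dominated (P * P') (S * S').
Proof.
move=> h h' i; rewrite !coefM (le_trans (ler_norm_sum _ _ _)) // ler_sum // => j _.
by rewrite normrM ler_pM.
Qed.

Lemma dominatedX : dominated 'X 'X.
Proof. by move=> i; rewrite coefX ger0_norm. Qed.

Lemma dominated_nat (a : nat) : dominated a%:R a%:R.
Proof. by move=> i; rewrite -polyC_natr coefC; case: eqP => _; rewrite ger0_norm ?ler0n. Qed.

Lemma dominated_lucas (x u v x' u' v' : {poly int}) (n : nat) :
  dominated x x' -> dominated u u' -> dominated v v' ->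
  dominated (lucas x u v n) (lucas x' u' v' n).
Proof.
move=> hx; elim: n u v u' v' => [|n IH] u v u' v' hu hv //=.
by apply: IH => //; apply: dominatedD => //; do !apply: dominatedM.
Qed.

Lemma dominated_coef_le (P S : {poly int}) (i : nat) :
  dominated P S -> `|P`_i| <= S.[1].
Proof.
move=> h; have S0 j : 0 <= S`_j := le_trans (normr_ge0 _) (h j).
rewrite horner_coef (le_trans (h i)) //.
have [lti|] := ltnP i (size S); last first.
  by move=> /(nth_default 0) ->; apply: sumr_ge0 => j _; rewrite expr1n mulr1.
rewrite (bigD1 (Ordinal lti)) //= expr1n mulr1 lerDl.
by apply: sumr_ge0 => j _; rewrite expr1n mulr1.
Qed.

Lemma dominated_height (P S : {poly int}) (n : nat) :
  dominated P S -> S.[1] <= n%:R -> (height P <= n)%N.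
Proof.
move=> h hn; apply/bigmax_leqP => i _.
have := le_trans (dominated_coef_le i h) hn.
by rewrite natz -abszE lez_nat.
Qed.

Lemma coef_le_height (P : {poly int}) (i : nat) : (absz (P`_i)%R <= height P)%N.
Proof.
have [lti|/(nth_default 0)->//] := ltnP i (size P).
exact: (leq_bigmax_cond (F := fun i : 'I_(size P) => absz P`_i) (Ordinal lti)).
Qed.

(** * The family of products and its height *)

Definition family (b : bool) (js : seq nat) (a : nat) : {poly int} :=
  'X^b * (cubic int a * \prod_(j <- js) qpoly int a j.*2.+1).

Lemma family_height (b : bool) (js : seq nat) :
  exists c : nat, forall a : nat, (0 < a)%N ->
    (height (family b js a) <= c * a ^ (size js).+2)%N.
Proof.
have [c hc] : exists c : nat, forall a : nat, (0 < a)%N ->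
    exists S, [/\ dominated (\prod_(j <- js) qpoly int a j.*2.+1) S, 0 <= S.[1]
      & S.[1] <= (c * a ^ size js)%N%:R].
  elim: js => [|j js [c IH]].
    exists 1%N => a _; exists 1; rewrite big_nil !hornerE; split=> //.
    exact: (dominated_nat 1).
  (* At 1 the initial values of the majorant sum to [a + 3], at most [4 a]; the power of 2 comes
     from [lucas1_le]. *)
  exists (2 ^ j.*2.+1 * 4 * c)%N => a a0; have [S [h1 h2 h3]] := IH a a0.
  exists (lucas 'X 1 ('X * 'X + a%:R * 'X + 1) j.*2.+1 * S); rewrite big_cons.
  have l0 n (u v : int) : 0 <= u -> 0 <= v -> 0 <= lucas 1 u v n.
    elim: n u v => [|n IHn] u v u0 v0 //=; apply: IHn => //.
    by rewrite expr1n mul1r addr_ge0.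
  split.
  - apply: dominatedM => //; apply: dominated_lucas; first exact: dominatedX.
      exact: (dominated_nat 1).
    apply: dominatedD; last exact: (dominated_nat 1).
    apply: dominatedD; first by apply: dominatedM; apply: dominatedX.
    by apply/dominatedN/dominatedM; [apply: dominated_nat|apply: dominatedX].
  - by rewrite hornerM horner_lucas mulr_ge0 // !hornerE horner_nat l0 // !addr_ge0 // ler0n.
  rewrite hornerM horner_lucas !hornerE horner_nat.
  have v0 : 0 <= 1 + a%:R + 1 :> int by rewrite !addr_ge0 // ler0n.
  apply: (@le_trans _ _ ((2 ^ j.*2.+1 * 4 * a)%N%:R * (c * a ^ size js)%N%:R)).
    apply: ler_pM => //; first exact: l0.
    apply: (le_trans (lucas1_le _ _ _)) => //.
    rewrite -mulnA natrM natrX ler_pM2l ?exprn_gt0 //.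
    have : 1 <= a%:R :> int by rewrite ler1n.
    by rewrite natrM; lra.
  by rewrite -natrM ler_nat /= [(a ^ _.+1)%N]expnS mulnACA.
(* The majorant of the cubic at 1 is [(1 + a) ^ 2 + a], at most [5 a ^ 2]. *)
exists (5 * c)%N => a a0; have [S [h1 h2 h3]] := hc a a0.
apply: (@dominated_height _ ('X^b * (('X * (('X + a%:R) * ('X + a%:R)) + a%:R) * S))).
  have hX := dominatedX; have ha := dominated_nat a.
  apply: dominatedM.
    by case: b => //; apply: (dominated_nat 1).
  apply: dominatedM => //; rewrite /cubic expr2.
  apply: dominatedD; last exact: dominatedN.
  by apply: dominatedM => //; apply: dominatedM; apply: dominatedD => //; apply: dominatedN.
rewrite !(hornerM, hornerD, hornerX, hornerXn, horner_nat) expr1n !mul1r.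
apply: (@le_trans _ _ ((5 * a ^ 2)%N%:R * (c * a ^ size js)%N%:R)).
  have a0' : 0 <= a%:R :> int by rewrite ler0n.
  apply: ler_pM => //.
  have : 1 <= a%:R :> int by rewrite ler1n.
  by rewrite natrM natrX; nra.
by rewrite -natrM ler_nat mulnACA -expnD add2n.
Qed.

Lemma family_monic_size (b : bool) (js : seq nat) (a : nat) :
  family b js a \is monic /\
  size (family b js a) = (b + 3 + \sum_(j <- js) j.+1.*2).+1.
Proof.
have [m3 s3] := cubic_monic_size int a.
have [mp sp] : \prod_(j <- js) qpoly int a j.*2.+1 \is monic /\
    size (\prod_(j <- js) qpoly int a j.*2.+1) = (\sum_(j <- js) j.+1.*2).+1.
  elim: js => [|j js [IH1 IH2]]; first by rewrite !big_nil monic1 size_poly1.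
  have [mj sj] := qpoly_monic_size int a j.
  rewrite !big_cons monicMl //; split=> //.
  rewrite size_mul ?monic_neq0 // IH2 sj; lia.
split; first by rewrite !monicMl ?monicXn.
rewrite size_mul ?monic_neq0 ?monicXn ?monicMl // size_polyXn.
rewrite size_mul ?monic_neq0 // s3 sp; lia.
Qed.

Lemma family_coef (b : bool) (js : seq nat) (a : nat) :
  (family b js a)`_b = - a%:R.
Proof.
rewrite /family mulrC coefMXn ltnn subnn -horner_coef0 hornerM horner_prod.
rewrite big1 => [|j _]; last exact: qpoly_at0.
by rewrite horner_cubic mul0r sub0r mulr1.
Qed.

Lemma family_height_ge (b : bool) (js : seq nat) (a : nat) :
  (a <= height (family b js a))%N.
Proof.
have := coef_le_height (family b js a) b.
by rewrite family_coef abszN natz.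
Qed.

(** * Clusters of roots *)

(** Each term [1 / (x - r)] of the logarithmic derivative is at most [1 / e] in absolute value; the
    denominators are cleared. *)
Lemma deriv_prod_XsubC_le (F : numFieldType) (s : seq F) (x e : F) :
  0 <= e -> (forall r, r \in s -> e <= `|x - r|) ->
  e * `|(\prod_(r <- s) ('X - r%:P))^`().[x]| <=
  (size s)%:R * `|(\prod_(r <- s) ('X - r%:P)).[x]|.
Proof.
move=> e0; elim: s => [|r s IH] h.
  by rewrite big_nil derivC hornerC normr0 mulr0 mul0r.
rewrite big_cons derivM derivXsubC mul1r !(hornerD, hornerM, hornerN, hornerX, hornerC).
set q := \prod_(_ <- _) _ in IH *.
have hr : e <= `|x - r| by apply: h; rewrite mem_head.
have /IH {}IH : forall t, t \in s -> e <= `|x - t|.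
  by move=> t ts; apply: h; rewrite inE ts orbT.
apply: (@le_trans _ _ (`|x - r| * `|q.[x]| + `|x - r| * ((size s)%:R * `|q.[x]|))).
  apply: (le_trans (ler_wpM2l e0 (ler_normD _ _))).
  rewrite mulrDr lerD ?ler_wpM2r // normrM mulrCA ler_wpM2l //.
by rewrite normrM /= -natr1 le_eqVlt; apply/orP; left; apply/eqP; ring.
Qed.

(* If every root were farther from [x], the logarithmic derivative
   [p'(x) / p(x)], the sum of the [1 / (x - r)], would be too small. *)
Lemma root_near (F : numClosedFieldType) (p : {poly F}) (x : F) :
  p \is monic -> p.[x] != 0 -> 1 <= `|p^`().[x]| ->
  exists2 r, root p r & `|x - r| <= (size p)%:R * `|p.[x]|.
Proof.
move=> mp px dp; have [s] := closed_field_poly_normal p.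
rewrite (monicP mp) scale1r => ep; subst p.
set p := \prod_(_ <- _) _ in mp px dp *.
have [//|no] := pselect (exists2 r, root p r & `|x - r| <= (size p)%:R * `|p.[x]|).
have sp : size p = (size s).+1 by rewrite size_prod_XsubC.
have E0 : 0 < `|p.[x]| by rewrite normr_gt0.
(* With this radius and derivative at least 1, the bound would give [size p <= size s], but [size p]
   is one more than the number of roots. *)
have := @deriv_prod_XsubC_le _ s x ((size p)%:R * `|p.[x]|) _ _.
rewrite -/p => H; suff : (size p)%:R <= (size s)%:R :> F by rewrite ler_nat sp ltnn.
rewrite -(ler_pM2r E0); apply: le_trans (H _ _).
- by rewrite ler_peMr // mulr_ge0.
- by rewrite mulr_ge0.
move=> r rs; rewrite real_leNgt ?realM ?normr_real ?realn //.
apply/negP => /ltW hle; apply: no; exists r => //.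
by rewrite root_prod_XsubC.
Qed.

(** The cubic changes sign between 0 and [2 / a]. *)
Lemma cubic_real_root (R : rcfType) (a : nat) : (2 < a)%N ->
  exists x : R, [/\ root (cubic R a) x, 0 < x & x <= 2 / a%:R].
Proof.
move=> a2; have A3 : 3 <= a%:R :> R by rewrite (ler_nat _ 3).
have [||x] := @poly_ivt R (cubic R a) 0 (2 / a%:R); last 1 first.
- move=> /andP[x0 x1] rx; exists x; split=> //.
  rewrite lt_neqAle x0 andbT; apply/eqP => e0; move/rootP: rx.
  by rewrite horner_cubic -e0 mul0r sub0r; lra.
- by rewrite divr_ge0 //; lra.
rewrite !horner_cubic mul0r sub0r oppr_le0 ler0n /=.
have -> : 2 / a%:R * (2 / a%:R - a%:R) ^+ 2 - a%:R =
    (a%:R ^+ 2 * (a%:R ^+ 2 - 8) + 8) / a%:R ^+ 3 :> R by field; lra.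
have A9 : 9 <= a%:R ^+ 2 :> R by nra.
rewrite divr_ge0 ?exprn_ge0 // addr_ge0 // mulr_ge0 //; lra.
Qed.

(** At a root of the cubic, [z (a - x) = - x], where [x] is at most [2 / a] and [a - x] at least
    [a / 2]. *)
Lemma cubic_root_param (R : realFieldType) (a : nat) (x : R) :
  (3 < a)%N -> root (cubic R a) x -> 0 < x -> x <= 2 / a%:R ->
  x ^+ 2 - a%:R * x + 1 != 0 /\ `|x ^+ 2 - a%:R * x + 1| <= 4 / a%:R ^+ 2.
Proof.
set z := _ + 1 => a3 rx x0 x1; have A3 : 4 <= a%:R :> R by rewrite (ler_nat _ 4).
have ax : a%:R * x <= 2 by rewrite mulrC -ler_pdivlMr //; lra.
have xa : a%:R / 2 <= a%:R - x by nra.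
have ez : z * (a%:R - x) = - x.
  have -> : z * (a%:R - x) = - x - (x * (x - a%:R) ^+ 2 - a%:R) by rewrite /z; ring.
  by rewrite -horner_cubic (rootP rx) subr0.
split; first by apply/eqP => e0; move: ez; rewrite e0 mul0r => ?; lra.
have en : `|z| * (a%:R - x) = x.
  by rewrite -[a%:R - x]ger0_norm -?normrM ?ez ?normrN ?gtr0_norm //; lra.
rewrite ler_pdivlMr ?exprn_gt0 //; last by lra.
have : `|z| * (a%:R / 2) <= x by rewrite -[leRHS]en ler_wpM2l.
by move=> h; nra.
Qed.

(** Differentiating the recurrence adds [2 x z ^ n], at most 1, and [x ^ 2] times an earlier
    derivative, which is nonpositive. So each step raises the initial bound [1 - a] by at most 1. *)
Lemma deriv_qpoly_root_le (R : realFieldType) (a n : nat) (x : R) :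
  (3 < a)%N -> root (cubic R a) x -> 0 < x -> x <= 2 / a%:R -> (n < a)%N ->
  (qpoly R a n.+1)^`().[x] <= n.+1%:R - a%:R.
Proof.
move=> a3 rx x0 x1; have A3 : 4 <= a%:R :> R by rewrite (ler_nat _ 4).
have ax : a%:R * x <= 2 by rewrite mulrC -ler_pdivlMr //; lra.
have [_] := cubic_root_param a3 rx x0 x1; set z := _ + 1 => zle.
have z1 : `|z| <= 1.
  by apply: (le_trans zle); rewrite ler_pdivrMr ?exprn_gt0 //; nra.
have x2 : 2 * x <= 1 by nra.
have D0 : (qpoly R a 0)^`().[x] <= 0 by rewrite /qpoly derivC hornerC.
have D1 : (qpoly R a 1)^`().[x] <= 1 - a%:R.
  rewrite /qpoly /= derivD derivB derivXn -polyC_natr mul_polyC derivZ derivX derivC.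
  by rewrite !hornerE; lra.
suff: (n < a)%N -> (qpoly R a n)^`().[x] <= 0 /\
  (qpoly R a n.+1)^`().[x] <= n.+1%:R - a%:R by move=> H /H [].
elim: n => [|n IH] na; first by [].
have [d0 d1] := IH (ltnW na); have na' : n.+1%:R <= a%:R :> R by rewrite ler_nat ltnW.
split; first by rewrite (le_trans d1) // subr_le0.
rewrite {1}/qpoly lucasSS -!/(qpoly _ _ _) derivD derivM derivXn !hornerE /=.
rewrite (qpoly_root_cubic _ rx) -/z.
have zn : z ^+ n <= 1.
  by rewrite (le_trans (ler_norm _)) // normrX exprn_ile1.
have x20 : 0 <= x ^+ 2 by rewrite sqr_ge0.
have : x ^+ 2 * (qpoly R a n)^`().[x] <= 0 by rewrite mulr_ge0_le0.
have : x *+ 2 * z ^+ n <= 1 by rewrite mulr2n; nra.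
by rewrite -[n.+2%:R]natr1 => *; lra.
Qed.

Lemma normcE_le (R : rcfType) (w : R[i]) (r : R) :
  (ComplexField.Normc.normc w <= r) = (`|w| <= r%:C%C).
Proof. by rewrite -lecR. Qed.

Lemma qpoly_root_near (R : rcfType) (a j : nat) (x : R) :
  (3 < a)%N -> (j.*2.+1 < a)%N -> root (cubic R a) x -> 0 < x ->
  x <= 2 / a%:R ->
  exists2 y : R[i], root (qpoly R[i] a j.*2.+1) y &
    `|x%:C%C - y| <= ((j.*2 + 3)%:R * (4 / a%:R ^+ 2) ^+ j.*2.+1)%:C%C.
Proof.
move=> a3 ja rx x0 x1; have [z0 z1] := cubic_root_param a3 rx x0 x1.
have [mq sq] := qpoly_monic_size R[i] a j.
have eq : qpoly R[i] a j.*2.+1 = map_poly (real_complex R) (qpoly R a j.*2.+1).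
  by rewrite map_qpoly.
have ev : (qpoly R[i] a j.*2.+1).[x%:C%C] = ((x ^+ 2 - a%:R * x + 1) ^+ j.*2.+1)%:C%C.
  by rewrite eq horner_map /= qpoly_root_cubic.
have := deriv_qpoly_root_le a3 rx x0 x1 (ltnW ja); set D := _.[x] => dq.
have ed : (qpoly R[i] a j.*2.+1)^`().[x%:C%C] = D%:C%C.
  by rewrite eq deriv_map horner_map.
have [||y ry hy] := root_near (x := x%:C%C) mq.
- by rewrite ev fmorph_eq0 expf_neq0.
- rewrite ed normc_def /= expr0n addr0 sqrtr_sqr lecR.
  have : j.*2.+2%:R <= a%:R :> R by rewrite ler_nat.
  rewrite -[j.*2.+2%:R]natr1 => h; have : D <= -1 by lra.
  by move=> h'; rewrite ler0_norm; lra.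
exists y => //; apply: (le_trans hy); rewrite sq ev rmorphM /= rmorph_nat.
rewrite ler_wpM2l ?ler0n // normc_def /= expr0n addr0 sqrtr_sqr lecR.
by rewrite normrX lerXn2r ?nnegrE // divr_ge0 ?exprn_ge0.
Qed.

(** Pairwise coprimality is kept in the conclusion because it later shows that the roots chosen for
    the cluster are distinct. *)
Lemma prod_qpoly_separable (F : numClosedFieldType) (js : seq nat) :
  uniq js ->
  eventuallyN (fun a => separable_poly (\prod_(j <- js) qpoly F a j.*2.+1) /\
    forall i j, i \in js -> j \in js -> i != j ->
      coprimep (qpoly F a i.*2.+1) (qpoly F a j.*2.+1)).
Proof.
move=> us.
have [N hN] := eventuallyN_all
  (fun j (_ : j \in js) => qpoly_separable F j.*2.+1).
have [N' hN'] : eventuallyN (fun a => forall ij, ij \in [seq (i, j) | i <- js, j <- js] ->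
    ij.1 != ij.2 -> coprimep (qpoly F a ij.1.*2.+1) (qpoly F a ij.2.*2.+1)).
  apply: eventuallyN_all => -[i j] _ /=.
  have [_|nij] := eqVneq i j; first by exists 0%N.
  have [|N1 h1] := @qpoly_coprime F i.*2.+1 j.*2.+1.
    by rewrite eqSS -!muln2 eqn_mul2r.
  by exists N1 => a /h1.
exists (maxn N N') => a; rewrite geq_max => /andP[/hN sep /hN' cop].
have {}cop i j : i \in js -> j \in js -> i != j ->
    coprimep (qpoly F a i.*2.+1) (qpoly F a j.*2.+1).
  by move=> ij jj; apply: (cop (i, j)); apply/allpairsP; exists (i, j).
split=> //; elim: js us sep cop {hN hN'} => [|j js IH] /= us sep cop.
  by rewrite big_nil unlock coprime1p.
case/andP: us => jn us; rewrite big_cons separable_mul sep ?mem_head //=.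
rewrite IH //=; last 2 first.
- by move=> i ij; apply: sep; rewrite inE ij orbT.
- by move=> i i' hi hi'; apply: cop; rewrite inE ?hi ?hi' orbT.
have : forall i, i \in js -> coprimep (qpoly F a j.*2.+1) (qpoly F a i.*2.+1).
  move=> i ij; apply: cop; rewrite ?mem_head // ?inE ?ij ?orbT //.
  by apply: contraNneq jn => ->.
elim: (js) => [|i s IHs] h; first by rewrite big_nil coprimep1.
rewrite big_cons coprimepMr h ?mem_head // IHs // => t ts.
by apply: h; rewrite inE ts orbT.
Qed.

Lemma map_family (F : numClosedFieldType) (b : bool) (js : seq nat) (a : nat) :
  map_poly intr (family b js a) =
  'X^b * (cubic F a * \prod_(j <- js) qpoly F a j.*2.+1).
Proof.
rewrite /family 2!rmorphM /= map_polyXn map_cubic rmorph_prod /=.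
by congr (_ * (_ * _)); apply: eq_bigr => j _; rewrite map_qpoly.
Qed.

Lemma family_separable (F : numClosedFieldType) (b : bool) (js : seq nat) (a : nat) :
  (2 < a)%N -> separable_poly (\prod_(j <- js) qpoly F a j.*2.+1) ->
  separable_poly (map_poly intr (family b js a) : {poly F}).
Proof.
move=> a2 sep; have a0 : (0 < a)%N by case: (a) a2.
rewrite map_family separable_mul separable_mul cubic_separable // sep.
have -> : coprimep (cubic F a) (\prod_(j <- js) qpoly F a j.*2.+1).
  elim: (js) => [|i s IHs]; first by rewrite big_nil coprimep1.
  by rewrite big_cons coprimepMr IHs cubic_qpoly_coprime.
case: b; last by rewrite expr0 coprime1p unlock coprime1p.
rewrite expr1 unlock derivX coprimep1 coprimep_sym coprimepX /=.
rewrite rootM negb_or /root cubic_at0 oppr_eq0 pnatr_eq0 -lt0n a0 horner_prod.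
by rewrite big1 ?oner_eq0 // => j _; rewrite qpoly_at0.
Qed.

(** Separation exponents are tested on full enumerations of the roots; this places a given cluster
    at the front of one. *)
Lemma extend_distinct_roots (R : realType) (P : {poly int}) (t : seq R[i]) :
  P \is monic -> separable_poly (map_poly intr P : {poly R[i]}) ->
  distinct_roots P t ->
  exists u, size (t ++ u) = (size P).-1 /\ distinct_roots P (t ++ u).
Proof.
move=> mP sep [ut rt]; have [s] := closed_field_poly_normal (map_poly intr P : {poly R[i]}).
have mP' : (map_poly intr P : {poly R[i]}) \is monic by rewrite monic_map.
rewrite (monicP mP') scale1r => es.
have us : uniq s by move: sep; rewrite es separable_prod_XsubC.
have ts : {subset t <= s}.
  by move=> y /(allP rt); rewrite es root_prod_XsubC.
pose u := [seq y <- s | y \notin t].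
have uu : uniq (t ++ u).
  rewrite cat_uniq ut filter_uniq //= andbT; apply/hasPn => y.
  by rewrite mem_filter => /andP[].
have e : t ++ u =i s.
  move=> y; rewrite mem_cat mem_filter; case: (boolP (y \in t)) => //= /ts.
  by move=> ->.
exists u; split.
  rewrite (perm_size (uniq_perm uu us e)) -(size_map_poly_id0 (f := intr : int -> R[i])).
    by rewrite es size_prod_XsubC.
  by rewrite (monicP mP) rmorph1 oner_eq0.
by split=> //; apply/allP => y; rewrite e es root_prod_XsubC.
Qed.

(* The cluster consists of the small real root of [cubic a], followed by a
   nearby root of each factor [qpoly a (2 j + 1)]. *)
Lemma family_cluster (R : realType) (b : bool) (js : seq nat) (l : nat) :
  uniq js -> all (leq l) js ->
  exists2 B : R, 0 < B & eventuallyN (fun a => exists s : seq R[i],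
    [/\ size s = (size (family b js a)).-1, distinct_roots (family b js a) s &
      forall i j, (i <= size js)%N -> (j <= size js)%N ->
        ComplexField.Normc.normc (s`_i - s`_j) <=
        B * (4 / a%:R ^+ 2) ^+ l.*2.+1]).
Proof.
move=> us lejs; pose T := (\max_(j <- js) (j.*2 + 3))%N.
(* Two points of the cluster are each within [T Y] of [x], with [Y] the power of [4 / a ^ 2]; the
   summand 1 keeps the constant positive when [js] is empty. *)
exists (2 * T%:R + 1); first by rewrite ltr_wpDl // mulr_ge0.
have [N hN] := prod_qpoly_separable R[i] us.
exists (maxn N (T + 4)) => a; rewrite geq_max => /andP[/hN [sep cop] Ta].
have a3 : (3 < a)%N by lia.
have [x [rx x0 x1]] := @cubic_real_root R a (ltnW a3).
have jT j : j \in js -> (j.*2 + 3 <= T)%N.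
  by move=> jj; apply: (@leq_bigmax_seq _ js predT (fun j => j.*2 + 3)%N).
have near j : exists y : R[i], j \in js -> root (qpoly R[i] a j.*2.+1) y /\
    `|x%:C%C - y| <= ((j.*2 + 3)%:R * (4 / a%:R ^+ 2) ^+ j.*2.+1)%:C%C.
  case: (boolP (j \in js)) => [jj|_]; last by exists 0.
  have [|y] := @qpoly_root_near R a j x a3 _ rx x0 x1; first by have := jT _ jj; lia.
  by move=> ry hy; exists y.
have {near} [f hf] := choice near.
pose Y : R := (4 / a%:R ^+ 2) ^+ l.*2.+1.
have A4 : 4 <= a%:R :> R by rewrite (ler_nat _ 4).
have Y0 : 0 <= Y by rewrite exprn_ge0 // divr_ge0 // exprn_ge0.
have close y : y \in x%:C%C :: map f js -> `|x%:C%C - y| <= (T%:R * Y)%:C%C.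
  rewrite inE => /orP[/eqP->|/mapP[j jj ->]].
    by rewrite subrr normr0 -[0]/(0%:C%C) lecR mulr_ge0.
  have [_ h] := hf j jj; apply: (le_trans h); rewrite lecR.
  apply: ler_pM => //; rewrite ?ler_nat ?jT ?exprn_ge0 ?divr_ge0 ?exprn_ge0 //.
  apply: ler_wiXn2l; rewrite ?divr_ge0 ?exprn_ge0 //.
    by rewrite ler_pdivrMr ?exprn_gt0 //; nra.
  by rewrite ltnS leq_double (allP lejs).
have rxC : root (cubic R[i] a) x%:C%C.
  by rewrite -(map_cubic (real_complex R)) /root horner_map (rootP rx) rmorph0.
have [m3 sz] := family_monic_size b js a.
have dt : distinct_roots (family b js a) (x%:C%C :: map f js).
  split.
    rewrite /= map_inj_in_uniq ?us ?andbT.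
      apply/mapP => -[j jj e]; have [rj _] := hf j jj.
      have := coprimep_root (cubic_qpoly_coprime R[i] j.*2.+1 (ltnW (ltnW (ltnW a3)))) rxC.
      by rewrite e (rootP rj) eqxx.
    (* Coprime factors share no root, so different indices give different roots. *)
    move=> i j ii jj e; apply/eqP; apply: contraT => nij.
    have [ri _] := hf i ii; have [rj _] := hf j jj.
    by have := coprimep_root (cop i j ii jj nij) ri; rewrite e (rootP rj) eqxx.
  rewrite map_family; apply/allP => y; rewrite inE => /orP[/eqP->|/mapP[j jj ->]].
    by rewrite !rootM rxC orbT.
  have [rj _] := hf j jj; rewrite !rootM; apply/orP; right; apply/orP; right.
  by rewrite (big_rem j) //= rootM rj.
have [u [su du]] := extend_distinct_roots m3 (family_separable b (ltnW a3) sep) dt.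
exists (x%:C%C :: map f js ++ u); split=> // i j ij jj.
have mem n : (n <= size js)%N -> (x%:C%C :: map f js ++ u)`_n \in x%:C%C :: map f js.
  by move=> hn; rewrite -cat_cons nth_cat /= size_map ltnS hn mem_nth //= size_map ltnS.
rewrite normcE_le -/Y (@le_trans _ _ ((T%:R * Y)%:C%C + (T%:R * Y)%:C%C)) //.
  set yi := _`_i; set yj := _`_j.
  rewrite -[yi - yj](subrKA x%:C%C) (le_trans (ler_normD _ _)) // lerD //.
    by rewrite distrC close // mem.
  by rewrite close // mem.
by rewrite -rmorphD lecR /= mulrDl mul1r; lra.
Qed.

Lemma root_dist_prod_le (R : realType) (k : nat) (s : seq R[i]) (Y : R) :
  (forall i j, (i < k)%N -> (j < k)%N ->
    ComplexField.Normc.normc (s`_i - s`_j) <= Y) ->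
  root_dist_prod k s <= Y ^+ 'C(k, 2).
Proof.
move=> h; have n0 (w : R[i]) : 0 <= ComplexField.Normc.normc w.
  by case: w => u v; apply: sqrtr_ge0.
rewrite -bin2_sum big_mkord -prodrXr.
apply: ler_prod => j _; rewrite prodr_ge0 //=.
rewrite -[X in Y ^+ X]card_ord -prodr_const.
by apply: ler_prod => i _; rewrite n0 h // (ltn_trans (ltn_ord i)).
Qed.

Lemma root_dist_prod_take (R : realType) (k : nat) (s : seq R[i]) :
  root_dist_prod k (take k s) = root_dist_prod k s.
Proof.
apply: eq_bigr => j _; apply: eq_bigr => i _.
by rewrite !nth_take // (ltn_trans (ltn_ord i)).
Qed.

(** * Polynomials with close roots *)

(** All but one of the indices are consecutive integers slightly below the average; the last one
    absorbs the remainder of the sum. *)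
Lemma balanced_indices (K D : nat) : (0 < K)%N -> (K * K.+1 <= D)%N ->
  exists js l, [/\ uniq js, size js = K, all (leq l) js,
    (\sum_(j <- js) j.+1 = D)%N & (D <= K * (l + K + 2))%N].
Proof.
case: K => // K _ hD; set q := (D %/ K.+1)%N.
have qD : (q * K.+1 <= D)%N by apply: leq_divM.
have Dq : (D < q.+1 * K.+1)%N by apply: ltn_ceil.
have hq : (K.+2 <= q)%N by rewrite leq_divRL // mulnC.
(* Starting [K.+2] below the quotient makes the remaining index [r] at least [l + K], hence
   different from the others. *)
pose l := (q - K.+2)%N; have ql : q = (l + K.+2)%N by rewrite subnK.
have siota m n : (\sum_(j <- iota m n) j.+1 <= n * (m + n))%N.
  elim: n m => [|n IH] m /=; first by rewrite big_nil.
  by rewrite big_cons; have := IH m.+1; nia.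
have := siota l K; set S := (\sum_(j <- _) _)%N => hS.
pose r := (D - S).-1.
have rS : (r.+1 + S = D)%N by rewrite /r; nia.
have hr : (l + K <= r)%N by nia.
exists (r :: iota l K), l; split=> /=.
- by rewrite iota_uniq andbT mem_iota negb_and -leqNgt hr orbT.
- by rewrite size_iota.
- rewrite (leq_trans (leq_addr K l) hr) /=; apply/allP => j.
  by rewrite mem_iota => /andP[].
- by rewrite big_cons.
nia.
Qed.

Lemma degree_decomposition (k d : nat) : (3 <= k)%N ->
  (4 + 2 * (k * k.-1) <= d)%N ->
  exists (b : bool) js l, [/\ uniq js, size js = k.-1, all (leq l) js,
    (b + 3 + \sum_(j <- js) j.+1.*2 = d)%N &
    (d <= l.*2.+1 * k.-1 + (4 + 4 * k ^ 2))%N].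
Proof.
case: k => // k k2 hd; pose D := ((d - 3) %/ 2)%N.
have [||js [l [us ss al sD hD]]] := @balanced_indices k D; [lia|rewrite /D; nia|].
exists (~~ odd d), js, l; split=> //.
  rewrite (eq_bigr (fun j => 2 * j.+1)%N) => [|j _]; last by rewrite mul2n.
  by rewrite -big_distrr /= sD /D; nia.
by rewrite /D in hD *; simpl; nia.
Qed.

Definition close_roots (R : realType) (d k : nat) (e : R) :=
  exists2 B : R, 0 < B & forall H0 : nat, exists (P : {poly int}) (s : seq R[i]),
    [/\ P \is monic /\ size P = d.+1, (H0 <= height P)%N,
      size s = d /\ distinct_roots P s &
      root_dist_prod k s <= B * (height P)%:R `^ (- e)].

Lemma close_roots_large (R : realType) (d k : nat) : (3 <= k)%N ->
  (4 + 2 * (k * k.-1) <= d)%N ->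
  close_roots d k (k%:R / k.+1%:R * d%:R - (4 + 4 * k ^ 2)%:R : R).
Proof.
move=> k3 hd; have [b [js [l [us ss al sd hl]]]] := degree_decomposition k3 hd.
have [B B0 [N hN]] := @family_cluster R b js l us al.
have [c hc] := family_height b js.
set e := _ - _; pose w := (l.*2.+1 * (k * k.-1))%N.
have we : k.+1%:R * e <= w%:R.
  rewrite /e /w mulrBr mulrA mulrCA divff ?pnatr_eq0 // mulr1 -!natrM.
  by rewrite lerBlDr -natrD ler_nat; nia.
pose B2 := (B * 4 ^+ l.*2.+1) ^+ 'C(k, 2).
have B20 : 0 < B2 by rewrite exprn_gt0 // mulr_gt0 // exprn_gt0.
exists (B2 * (1 + c%:R `^ e)); first by rewrite mulr_gt0 // ltr_wpDr // powR_ge0.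
move=> H0; pose a := (maxn N (maxn H0 1)); exists (family b js a).
have [|s [sz ds hs]] := hN a; first exact: leq_maxl.
have a0 : (0 < a)%N by rewrite /a; lia.
have [mP sP] := family_monic_size b js a; rewrite sd in sP.
rewrite sP /= in sz; have aH := family_height_ge b js a.
have {hc} := hc a a0; rewrite ss; set H := height _ in aH * => Hc.
exists s; split=> //; first by apply: leq_trans aH; rewrite /a; lia.
have a1 : 1 <= a%:R :> R by rewrite ler1n.
have H1 : 1 <= H%:R :> R by rewrite ler1n (leq_trans a0).
have le1 : root_dist_prod k s <= B2 * a%:R ^- w.
  have -> : B2 * a%:R ^- w = (B * (4 / a%:R ^+ 2) ^+ l.*2.+1) ^+ 'C(k, 2).
    have -> : w = (2 * (l.*2.+1 * 'C(k, 2)))%N.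
      by rewrite /w -[k.-1]bin1 mul_bin_diag mulnCA.
    by rewrite expr_div_n mulrA expr_div_n !exprM.
  by apply: root_dist_prod_le => i j ik jk; apply: hs; rewrite ss; lia.
apply: (le_trans le1); rewrite -mulrA ler_pM2l // mulrDl mul1r.
have [e0|e0] := leP e 0.
  rewrite ler_wpDr ?mulr_ge0 ?powR_ge0 //.
  apply: (@le_trans _ _ 1); first by rewrite invf_le1 ?exprn_ege1 // exprn_gt0 // ltr0n.
  by have := @ler_powR R H%:R H1 0 (- e); rewrite powRr0 oppr_ge0; apply.
rewrite ler_wpDl ?powR_ge0 // powRN -[leLHS]mul1r ler_pdivrMr ?exprn_gt0 ?ltr0n //.
rewrite mulrAC ler_pdivlMr ?powR_gt0 ?(lt_le_trans _ H1) // mul1r.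
apply: (@le_trans _ _ ((c * a ^ k.-1.+2)%N%:R `^ e)).
  by apply: ge0_ler_powR; rewrite ?nnegrE ?ler0n ?ler_nat // ltW.
rewrite natrM powRM // ler_wpM2l ?powR_ge0 // natrX -!powR_mulrn ?ler0n // -powRrM.
by apply: ler_powR => //; rewrite prednK //; lia.
Qed.

Lemma close_roots_small (R : realType) (d k : nat) (e : R) : (k <= d)%N ->
  (0 < d)%N -> e <= - 'C(k, 2)%:R -> close_roots d k e.
Proof.
move=> kd d0 he; exists (2 ^+ 'C(k, 2)); first exact: exprn_gt0.
move=> H0; pose N := maxn H0 1; pose P : {poly int} := 'X^d - N%:R%:P.
have N0 : (0 < N)%N by rewrite /N; lia.
have mP : P \is monic by apply: monicXnsubC.
have sP : size P = d.+1 by apply: size_XnsubC.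
have HN : (N <= height P)%N.
  have := coef_le_height P 0; rewrite coefB coefXn coefC eqxx.
  by rewrite (ltn_eqF d0) sub0r abszN natz.
have eP : map_poly intr P = 'X^d - N%:R%:P :> {poly R[i]}.
  by rewrite rmorphB /= map_polyXn map_polyC /= rmorph_nat.
have sep : separable_poly (map_poly intr P : {poly R[i]}).
  rewrite eP unlock; apply/Pdiv.ClosedField.coprimepP => y /rootP.
  rewrite derivB derivXn derivC subr0 !hornerE => hy.
  rewrite hornerMn hornerXn mulrn_eq0 negb_or -lt0n d0 /=.
  rewrite expf_eq0; apply/negP => /andP[_ /eqP y0]; move: hy.
  rewrite y0 expr0n gtn_eqF // sub0r => /eqP.
  by rewrite oppr_eq0 pnatr_eq0 gtn_eqF.
have [|s [ss ds]] := @extend_distinct_roots R P [::] mP sep; first by split.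
rewrite /= in ss ds; exists P, s; split=> //; first by apply: leq_trans HN; rewrite /N; lia.
  by rewrite ss sP.
have rN i : (i < k)%N -> `|s`_i| <= N%:R.
  move=> ik; case: ds => _ /allP /(_ s`_i).
  rewrite mem_nth ?ss ?sP ?(leq_trans ik) // => /(_ isT) /rootP.
  rewrite eP !hornerE => /subr0_eq /(congr1 Num.norm); rewrite normrX normr_nat => h.
  rewrite -h; apply: ler_eXnr => //.
  rewrite real_leNgt ?normr_real // ; apply/negP => lt1.
  have : `|s`_i| ^+ d < 1 by rewrite exprn_ilt1 // -lt0n.
  by rewrite h ltrn1; case: (N) N0.
apply: (@le_trans _ _ ((2 * N%:R) ^+ 'C(k, 2))).
  apply: root_dist_prod_le => i j ik jk; rewrite normcE_le (le_trans (ler_normB _ _)) //.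
  by rewrite rmorphM /= !rmorph_nat mulr_natl mulr2n lerD ?rN.
rewrite exprMn ler_pM2l ?exprn_gt0 // -powR_mulrn ?ler0n //.
apply: (@le_trans _ _ ((height P)%:R `^ 'C(k, 2)%:R)).
  by apply: ge0_ler_powR; rewrite ?nnegrE ?ler0n ?ler_nat.
apply: ler_powR; last by lra.
by rewrite ler1n (leq_trans N0).
Qed.

Lemma close_roots_exist (R : realType) (d k : nat) : (3 <= k <= d)%N ->
  close_roots d k (k%:R / k.+1%:R * d%:R - (4 + 4 * k ^ 2)%:R : R).
Proof.
case/andP=> k3 kd; have [|lt] := leqP (4 + 2 * (k * k.-1)) d.
  exact: close_roots_large.
apply: close_roots_small => //; first by lia.
have : k%:R / k.+1%:R * d%:R <= d%:R :> R.
  by rewrite ler_piMl ?ler0n // ler_pdivrMr ?ltr0n // mul1r ler_nat.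
have : (d + 'C(k, 2) <= 4 + 4 * k ^ 2)%N.
  have : (k * k.-1 = 2 * 'C(k, 2))%N by rewrite -mul_bin_diag bin1.
  nia.
rewrite -(ler_nat R) natrD lerBlDr; set c := (_ + _)%:R => h1 h2.
by apply: (le_trans h2); rewrite addrC lerBrDr.
Qed.

Lemma powR_unbounded (R : realType) (B g : R) : 0 < g ->
  exists H0 : nat, forall H : nat, (H0 <= H)%N -> B < H%:R `^ g.
Proof.
move=> g0; pose M := (`|B| + 1) `^ g^-1.
exists (Num.truncn M).+1 => H hH.
have MH : M < H%:R by apply: (lt_le_trans (truncnS_gt _)); rewrite ler_nat.
apply: (@lt_trans _ _ (`|B| + 1)); first by rewrite (le_lt_trans (ler_norm _)) // ltrDl.
have -> : `|B| + 1 = M `^ g.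
  by rewrite -powRrM mulVf ?gt_eqF // powRr1 // addr_ge0.
by apply: gt0_ltr_powR; rewrite ?nnegrE ?powR_ge0.
Qed.

Lemma close_roots_contra (R : realType) (d k : nat) (e delta c : R) (H0 : nat) :
  close_roots d k e -> delta < e -> 0 < c ->
  ~ (forall (P : {poly int}) (s : seq R[i]),
       P \is monic -> size P = d.+1 -> (H0 <= height P)%N -> size s = d ->
       distinct_roots P s ->
       c * (height P)%:R `^ (- delta) <= root_dist_prod k s).
Proof.
move=> [B B0 hB] lte c0 h.
have [|H1 hH1] := @powR_unbounded R (B / c) (e - delta); first by rewrite subr_gt0.
have [P [s [[mP sP] hH [ss ds] le]]] := hB (maxn 1 (maxn H0 H1)).
have hp : 0 < (height P)%:R :> R by rewrite ltr0n; lia.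
have h1 := hH1 (height P) (leq_trans (leq_maxr _ _) (leq_trans (leq_maxr _ _) hH)).
have hH' := leq_trans (leq_maxl _ _) (leq_trans (leq_maxr _ _) hH).
have := le_trans (h P s mP sP hH' ss ds) le.
set x : R := (height P)%:R in hp h1 *.
rewrite leNgt => /negP; apply.
have -> : x `^ (- delta) = x `^ (e - delta) * x `^ (- e).
  rewrite -powRD; first by congr (x `^ _); ring.
  by apply/implyP => _; rewrite gt_eqF.
by rewrite mulrA ltr_pM2r ?powR_gt0 // mulrC -ltr_pdivrMr.
Qed.

Lemma le_Estar (R : realType) (d k : nat) (e : R) :
  close_roots d k e -> (e%:E <= Estar R d k)%E.
Proof.
move=> he; apply: le_ereal_inf_tmp => _ [delta [H0 h] <-]; rewrite lee_fin leNgt.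
apply/negP => lt; apply: (close_roots_contra (H0 := H0) he lt ltr01) => P s mP sP hH ss ds.
by rewrite mul1r; apply: h.
Qed.

Lemma Estar_le_E (R : realType) (d k : nat) : (Estar R d k <= E R d k)%E.
Proof.
apply: ereal_inf_le_tmp => _ [delta [H0 h] <-]; exists delta => //.
by exists H0 => P s _; apply: h.
Qed.

Theorem theorem4 (R : realType) :
  (forall k : nat, (3 <= k)%N ->
     exists c1 c2 : rat, forall d : nat, (k <= d)%N ->
       ((k%:R / (k.+1)%:R * d%:R - ratr c1)%:E <= E R d k)%E /\
       ((k%:R / (k.+1)%:R * d%:R - ratr c2)%:E <= Estar R d k)%E) /\
  (forall (k : nat) (a : R), (3 <= k)%N -> a < k%:R / (k.+1)%:R ->
     ~ (forall d : nat, (k <= d)%N ->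
          exists2 c : R, 0 < c &
            forall (P : {poly int}) (s : seq R[i]),
              P \is monic -> size P = d.+1 ->
              size s = k -> distinct_roots P s ->
              c * (height P)%:R `^ (- (a * d%:R)) <= root_dist_prod k s)).
Proof.
split=> [k k3|k a k3 ak h].
  exists (4 + 4 * k ^ 2)%:R, (4 + 4 * k ^ 2)%:R => d kd; rewrite ratr_nat.
  have H : ((k%:R / k.+1%:R * d%:R - (4 + 4 * k ^ 2)%:R)%:E <= Estar R d k)%E.
    by apply/le_Estar/close_roots_exist/andP.
  by split=> //; apply: le_trans H (Estar_le_E _ _ _).
set c0 : R := (4 + 4 * k ^ 2)%:R; pose g := k%:R / k.+1%:R - a.
have g0 : 0 < g by rewrite subr_gt0.
pose d := maxn k (Num.truncn (c0 / g)).+1; have kd : (k <= d)%N by apply: leq_maxl.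
have [c c_gt0 hc] := h d kd.
have lt : a * d%:R < k%:R / k.+1%:R * d%:R - c0.
  have : c0 / g < d%:R.
    by apply: (lt_le_trans (truncnS_gt _)); rewrite ler_nat leq_maxr.
  by rewrite ltr_pdivrMr // mulrC mulrBl !ltrBrDr addrC.
have cr := close_roots_exist R (introT andP (conj k3 kd)).
apply: (close_roots_contra (H0 := 0) cr lt c_gt0) => P s mP sP _ ss [us rs].
rewrite -root_dist_prod_take; apply: hc => //; first by rewrite size_takel // ss.
split; first exact: take_uniq.
by apply/allP => y /mem_take /(allP rs).
Qed.
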